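(* There exists a finite constant $C_0$, independent of $N$, such that $|\rho_N(0)-\rho(0)|\le C_0/\sqrt{\ell_N}$. Moreover, for any continuous function $G:[0,1]\to\mathbb{R}$, $$\lim_{N\to\infty}E_{\mu_N}\Big[\,\Big|\frac1N\sum_{k=1}^{N-1}G(k/N)\,[\eta_k-\bar u(k/N)]\,\Big|\,\Big]=0,$$ where $\bar u:[0,1]\to\mathbb{R}$ is the unique solution of the linear equation $\Delta u=0$ on $(0,1)$, $u(0)=\rho(0)$, $u(1)=\beta$.
   Context: Fix an integer $p>1$ and $\beta\in(0,1)$. Let $\Lambda_p^*=\{-p,\dots,0\}$, $\Omega_p^*=\{0,1\}^{\Lambda_p^*}$ and, for $N\ge2$, $\Lambda_{N,p}=\{-p,\dots,N-1\}$, $\Omega_{N,p}=\{0,1\}^{\Lambda_{N,p}}$. Let $L_l$ be the generator of an (arbitrary) irreducible continuous-time Markov chain on $\Omega_p^*$, let $\mu$ be its unique stationary state and $\rho(k)=E_\mu[\eta_k]$, $k\in\Lambda_p^*$. Fix a sequence $\ell_N>0$ with $\ell_N\to\infty$. $\sigma^{j,k}\eta$ is obtained from $\eta$ by exchanging $\eta_j,\eta_k$, and $\sigma^k\eta$ by replacing $\eta_k$ by $1-\eta_k$. Consider the Markov chain on $\Omega_{N,p}$ with generator $L_N=\ell_NL_l+L_{0,1}+L_{b,N}+L_{r,N}$, where $L_l$ acts on the coordinates in $\Lambda_p^*$ and $$(L_{0,1}f)(\eta)=f(\sigma^{0,1}\eta)-f(\eta),\qquad (L_{b,N}f)(\eta)=\sum_{k=1}^{N-2}\{f(\sigma^{k,k+1}\eta)-f(\eta)\},$$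 $$(L_{r,N}f)(\eta)=\{\beta(1-\eta_{N-1})+(1-\beta)\eta_{N-1}\}\{f(\sigma^{N-1}\eta)-f(\eta)\}.$$ This chain has a unique stationary state $\mu_N$, with expectation $E_{\mu_N}$; $\rho_N(k)=E_{\mu_N}[\eta_k]$, $k\in\Lambda_{N,p}$. *)

(* Defs.v *)
From HB Require Import structures.
From mathcomp Require Import all_boot all_order all_algebra perm.
From mathcomp Require Import all_classical all_reals all_analysis.

Set Implicit Arguments.
Unset Strict Implicit.
Unset Printing Implicit Defensive.

Import Order.TTheory GRing.Theory Num.Theory.
Import numFieldNormedType.Exports.

Local Open Scope classical_set_scope.
Local Open Scope ring_scope.

(** ** Continuous-time Markov chains on a finite set *)

(** Jump rates; the diagonal entries play no role below, so that both the
    convention "zero diagonal" and the Q-matrix convention are covered. *)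
Definition jump_rates (R : realType) (T : finType) (r : T -> T -> R) : Prop :=
  forall x y : T, x != y -> 0 <= r x y.

Definition generator (R : realType) (T : finType) (r : T -> T -> R)
    (f : T -> R) (x : T) : R :=
  \sum_(y : T) r x y * (f y - f x).

Definition irreducible_rates (R : realType) (T : finType) (r : T -> T -> R)
    : Prop :=
  forall x y : T, connect (fun a b : T => (a != b) && (0 < r a b)) x y.

Definition expect (R : realType) (T : finType) (mu : T -> R) (f : T -> R) : R :=
  \sum_(x : T) mu x * f x.

Definition prob_mass (R : realType) (T : finType) (mu : T -> R) : Prop :=
  (forall x : T, 0 <= mu x) /\ \sum_(x : T) mu x = 1.

Definition stationary (R : realType) (T : finType)
    (L : (T -> R) -> T -> R) (mu : T -> R) : Prop :=
  prob_mass mu /\ forall f : T -> R, expect mu (L f) = 0.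

(** ** Configurations *)

(** [Lambda p N] is {-p, ..., N-1} for N >= 1: the ordinal [i] stands for the
    site [i - p], and [site p N k] is the ordinal of the site [k] (meaningful
    only if -p <= k <= N-1).  In particular [Lambda p 1] is {-p, ..., 0}. *)
Definition Lambda (p N : nat) := 'I_(N.-1 + p).+1.

Definition site (p N : nat) (k : int) : Lambda p N := inord (absz (k + p%:Z)).

Definition Omega (p N : nat) := {ffun Lambda p N -> bool}.

Definition occ (R : realType) (p N : nat) (eta : Omega p N) (k : int) : R :=
  (eta (site p N k))%:R.

Definition density (R : realType) (p N : nat) (mu : Omega p N -> R) (k : int)
    : R :=
  expect mu (fun eta => occ R eta k).

Definition exchange (p N : nat) (j k : int) (eta : Omega p N) : Omega p N :=
  [ffun i => eta (tperm (site p N j) (site p N k) i)].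

Definition flip (p N : nat) (k : int) (eta : Omega p N) : Omega p N :=
  [ffun i => if i == site p N k then ~~ eta i else eta i].

(** Restriction of a configuration to {-p, ..., 0}, and replacement of the
    coordinates of [eta] in {-p, ..., 0} by those of [xi]. *)
Definition left_part (p N : nat) (eta : Omega p N) : Omega p 1 :=
  [ffun i : Lambda p 1 => eta (inord i)].

Definition set_left (p N : nat) (xi : Omega p 1) (eta : Omega p N)
    : Omega p N :=
  [ffun i : Lambda p N => if (i <= p)%N then xi (inord i) else eta i].

(** ** The generator L_N *)

Definition L_left (R : realType) (p N : nat) (r : Omega p 1 -> Omega p 1 -> R)
    (f : Omega p N -> R) (eta : Omega p N) : R :=
  generator r (fun xi => f (set_left xi eta)) (left_part eta).

Definition L_01 (R : realType) (p N : nat) (f : Omega p N -> R)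
    (eta : Omega p N) : R :=
  f (exchange 0 1 eta) - f eta.

Definition L_bulk (R : realType) (p N : nat) (f : Omega p N -> R)
    (eta : Omega p N) : R :=
  \sum_(1 <= k < N.-1) (f (exchange k%:Z k.+1%:Z eta) - f eta).

Definition L_right (R : realType) (p N : nat) (beta : R) (f : Omega p N -> R)
    (eta : Omega p N) : R :=
  (beta * (1 - occ R eta N.-1%:Z) + (1 - beta) * occ R eta N.-1%:Z)
  * (f (flip N.-1%:Z eta) - f eta).

Definition L_full (R : realType) (p N : nat) (beta l : R)
    (r : Omega p 1 -> Omega p 1 -> R) (f : Omega p N -> R) (eta : Omega p N)
    : R :=
  l * L_left r f eta + L_01 f eta + L_bulk f eta + L_right beta f eta.

(** ** The limiting equation *)

(** Classical solutions of u'' = 0 on (0,1), continuous on [0,1], with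
    u(0) = a and u(1) = b; the values of [u] outside [0,1] are irrelevant. *)
Definition dirichlet_solution (R : realType) (a b : R) (u : R -> R) : Prop :=
  [/\ {within `[0, 1], continuous u},
      forall x : R, 0 < x < 1 ->
        [/\ derivable u x 1, derivable (derive1 u) x 1 & derive1 (derive1 u) x = 0],
      u 0 = a
    & u 1 = b].

(* Main.v *)
Require Import Defs.
From HB Require Import structures.
From mathcomp Require Import all_boot all_order all_algebra perm.
From mathcomp Require Import all_classical all_reals all_analysis.
From mathcomp Require Import ring lra zify.

Set Implicit Arguments.
Unset Strict Implicit.
Unset Printing Implicit Defensive.

Import Order.TTheory GRing.Theory Num.Theory.
Import numFieldNormedType.Exports.

Local Open Scope classical_set_scope.
Local Open Scope ring_scope.

(** Two exact identities make this chain tractable.  The bulk stirring and the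
    right reservoir map a one-point function to its discrete Laplacian, with
    the reservoir appearing as a site N of constant value [beta]
    ([L_full_occ]); and the carre du champ of two distinct occupation variables
    lives on nearest neighbours only ([carre_occ]).  So the equations for the
    one- and two-point functions of the stationary state are closed, except
    that their left boundary values involve site 0, where the fast unknown
    dynamics acts.

    The left boundary is handled by the Poisson equation for the fast chain.
    Irreducibility gives [F] with [generator r F = eta_0 - rho(0)]
    ([poisson_equation]).  Testing stationarity against [F * g], where [g] does
    not depend on the left block, the fast part contributes
    [ell * E[(eta_0 - rho(0)) g]] and all the rest is bounded, so this
    expectation is O(1/ell) ([left_decoupling]).  Taking [g = 1] gives the
    density estimate at the rate 1/ell, which is at most 1/sqrt(ell) when
    ell >= 1; for smaller ell, two densities differ by at most 1.
    Taking for [g] a centred occupation variable shows that the correlations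
    between site 0 and the bulk are O(1/ell).

    The mean occupation is discrete harmonic, hence affine, so it converges
    uniformly to the affine function [ubar].  The correlations solve a discrete
    Dirichlet problem on the triangle 0 <= j < k <= N, with data O(1/ell) on one
    side, 0 on the other, and a source equal to the squared slope of the mean
    profile, O(1/N^2), next to the diagonal.  The source is absorbed by a
    multiple of [j (N - k)], and the maximum principle yields correlations of
    size O(1/ell + 1/N) uniformly ([corr_le]).  The second moment of the
    fluctuations of the empirical average then vanishes, uniformly over [G] of
    given supremum norm ([empirical_average_le]). *)

(** * Expectations over a finite set *)

Section Expectation.
Variables (R : realType) (T : finType) (mu : T -> R).
Implicit Types f g : T -> R.

Lemma expect_ext f g : f =1 g -> expect mu f = expect mu g.
Proof. by move=> fg; apply: eq_bigr => x _; rewrite fg. Qed.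

Lemma expectD f g :
  expect mu (fun x => f x + g x) = expect mu f + expect mu g.
Proof. by rewrite -big_split; apply: eq_bigr => x _; rewrite mulrDr. Qed.

Lemma expectZ c f : expect mu (fun x => c * f x) = c * expect mu f.
Proof. by rewrite /expect mulr_sumr; apply: eq_bigr => x _; rewrite mulrCA. Qed.

Lemma expectB f g :
  expect mu (fun x => f x - g x) = expect mu f - expect mu g.
Proof. by rewrite -sumrB; apply: eq_bigr => x _; rewrite mulrBr. Qed.

Lemma expect_sum (I : Type) (s : seq I) (F : I -> T -> R) :
  expect mu (fun x => \sum_(i <- s) F i x) = \sum_(i <- s) expect mu (F i).
Proof.
by rewrite /expect exchange_big; apply: eq_bigr => x _; rewrite mulr_sumr.
Qed.

Hypothesis mu_prob : prob_mass mu.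

Lemma expect_cst c : expect mu (fun=> c) = c.
Proof. by rewrite /expect -mulr_suml mu_prob.2 mul1r. Qed.

Lemma expect_le f g : (forall x, f x <= g x) -> expect mu f <= expect mu g.
Proof.
by move=> fg; apply: ler_sum => x _; rewrite ler_wpM2l ?mu_prob.1.
Qed.

Lemma expect_norm_le f K : (forall x, `|f x| <= K) -> `|expect mu f| <= K.
Proof.
move=> fK; rewrite ler_norml -{1}(expect_cst (- K)) -{2}(expect_cst K).
by apply/andP; split; apply: expect_le => x;
  move: (fK x); rewrite ler_norml => /andP[].
Qed.

End Expectation.

Section Concentration.
Variables (R : realType) (T : finType) (mu : T -> R).
(** Expectation of the inequality [2 |f| <= e + f^2 / e]; a form of
    Cauchy-Schwarz without square roots. *)
Lemma expect_norm_le_sqr (f : T -> R) (e : R) : prob_mass mu -> 0 < e ->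
  expect mu (fun x => `|f x|) <= (e + expect mu (fun x => f x ^+ 2) / e) / 2.
Proof.
move=> mu_prob e0.
have -> : (e + expect mu (fun x => f x ^+ 2) / e) / 2 =
    expect mu (fun x => 2^-1 * (e + e^-1 * f x ^+ 2)).
  by rewrite expectZ expectD expect_cst // expectZ mulrC [e^-1 * _]mulrC.
apply: expect_le => // x.
have : 0 <= (e - `|f x|) ^+ 2 / e by rewrite divr_ge0 ?sqr_ge0 // ltW.
have -> : (e - `|f x|) ^+ 2 / e = e - 2 * `|f x| + e^-1 * f x ^+ 2.
  by rewrite -[f x ^+ 2]real_normK ?num_real //; field; rewrite gt_eqF.
by move=> h; lra.
Qed.

(** The diagonal contributes N terms out of N^2, whence the 1/N. *)
Lemma second_moment_average (N : nat) (X : nat -> T -> R) (g : nat -> R)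
    (M delta : R) : (0 < N)%N -> 0 <= M -> 0 <= delta ->
  (forall k, (1 <= k < N)%N -> `|g k| <= M) ->
  (forall j k, (1 <= j < N)%N -> (1 <= k < N)%N ->
     `|expect mu (fun x => X j x * X k x)| <= (j == k)%:R + delta) ->
  expect mu (fun x => (N%:R^-1 * \sum_(1 <= k < N) g k * X k x) ^+ 2)
  <= M ^+ 2 * (N%:R^-1 + delta).
Proof.
move=> N0 M0 d0 gM Xcorr; have NR : 0 < N%:R :> R by rewrite ltr0n.
have count_le (c : R) : 0 <= c -> \sum_(1 <= k < N) c <= N%:R * c.
  move=> c0; rewrite sumr_const_nat -[leLHS]mulr_natl ler_wpM2r // ler_nat; lia.
under expect_ext => x.
  rewrite exprMn [X in _ * X]expr2 big_distrlr /=.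
  under eq_bigr => j _ do under eq_bigr => k _ do rewrite mulrACA.
  over.
rewrite expectZ expect_sum.
under eq_bigr => j _.
  rewrite expect_sum; under eq_bigr => k _ do rewrite expectZ.
  over.
have -> : M ^+ 2 * (N%:R^-1 + delta) =
    N%:R^-1 ^+ 2 * (N%:R * (M ^+ 2 * (1 + N%:R * delta))).
  by field; rewrite gt_eqF.
apply: ler_wpM2l; first by rewrite exprn_ge0 // invr_ge0 ltW.
have row_ge0 : 0 <= M ^+ 2 * (1 + N%:R * delta).
  by rewrite mulr_ge0 ?exprn_ge0 // addr_ge0 // mulr_ge0 // ltW.
apply: le_trans (count_le _ row_ge0); apply: ler_sum_nat => j jN.
apply: (@le_trans _ _ (\sum_(1 <= k < N) M ^+ 2 * ((j == k)%:R + delta))).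
  apply: ler_sum_nat => k kN; apply: le_trans (ler_norm _) _.
  rewrite normrM normrM expr2.
  by apply: ler_pM => //; [apply: ler_pM; rewrite ?gM|exact: Xcorr].
rewrite -mulr_sumr ler_wpM2l ?exprn_ge0 // big_split /= lerD //.
  under eq_bigr do rewrite eq_sym mulrb.
  by rewrite -big_mkcond big_nat1_eq jN.
exact: count_le.
Qed.

End Concentration.

(** * The Poisson equation of an irreducible chain *)

Section Poisson.
Variables (R : realType) (T : finType) (r : T -> T -> R).
Hypotheses (r_ge0 : jump_rates r) (r_irr : irreducible_rates r).

(** Maximum principle: harmonicity at a maximum point forces the value of [f] to
    be the same at all states reachable in one jump, hence everywhere. *)
Lemma generator_kernel_cst (f : T -> R) :
  (forall x, generator r f x = 0) -> forall x y, f x = f y.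
Proof.
move=> Lf0 x y.
case: (@arg_maxP _ R T x xpredT f isT) => m _ fm.
have step a b : f a = f m -> (a != b) && (0 < r a b) -> f b = f m.
  move=> fa /andP[ab rab].
  have terms_ge0 z : 0 <= r a z * (f a - f z).
    have [->|az] := eqVneq a z; first by rewrite subrr mulr0.
    by rewrite mulr_ge0 ?r_ge0 // subr_ge0 fa; exact: fm.
  have /eqP : \sum_z r a z * (f a - f z) = 0.
    transitivity (- generator r f a); last by rewrite Lf0 oppr0.
    rewrite /generator -sumrN.
    by apply: eq_bigr => z _; rewrite -mulrN opprB.
  rewrite psumr_eq0 // => /allP/(_ b (mem_index_enum _)) /=.
  by rewrite mulf_eq0 gt_eqF //= subr_eq0 fa => /eqP.
have max_everywhere z : f z = f m.
  have /connectP[s + ->] := r_irr m z.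
  elim/last_ind: s => //= s b IH; rewrite rcons_path last_rcons => /andP[/IH].
  exact: step.
by rewrite !max_everywhere.
Qed.

(** Rank count: the kernel of the generator is one-dimensional, so its image has
    codimension one; stationarity puts this image inside the hyperplane of
    functions of zero mean, and both must coincide. *)
Lemma poisson_equation (mu g : T -> R) : stationary (generator r) mu ->
  expect mu g = 0 -> exists f : T -> R, forall x, generator r f x = g x.
Proof.
move=> [mu_prob mu_stat] g0; pose n := #|T|.
pose vec (f : T -> R) : 'rV[R]_n := \row_i f (enum_val i).
pose fct (u : 'rV[R]_n) (x : T) : R := u 0 (enum_rank x).
(* Row vectors represent functions, so [L] is the transpose of the generator
   and acts on the right. *)
pose L : 'M[R]_n := \matrix_(i, j)
  (r (enum_val j) (enum_val i) -
     (i == j)%:R * \sum_y r (enum_val j) y).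
have LE (f : T -> R) : vec f *m L = vec (generator r f).
  apply/rowP => j; rewrite !mxE /generator.
  under eq_bigr do rewrite !mxE mulrBr.
  rewrite sumrB; under [in RHS]eq_bigr do rewrite mulrBr.
  rewrite sumrB; congr (_ - _).
    by rewrite [RHS](reindex _ (onW_bij _ (@enum_val_bij T))) /=;
      apply: eq_bigr => i _; rewrite mulrC.
  rewrite (bigD1 j) //= eqxx mul1r [X in _ + X]big1; last first.
    by move=> i /negbTE ->; rewrite mul0r mulr0.
  by rewrite addr0 mulr_sumr; apply: eq_bigr => y _; rewrite mulrC.
have fctK u : vec (fct u) = u.
  by apply/rowP => i; rewrite mxE /fct enum_valK.
pose m : 'cV[R]_n := (vec mu)^T.
have mE (f : T -> R) : vec f *m m = (expect mu f)%:M.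
  apply/matrixP => i j; rewrite !ord1 !mxE eqxx mulr1n /expect.
  rewrite [RHS](reindex _ (onW_bij _ (@enum_val_bij T))) /=.
  by apply: eq_bigr => k _; rewrite !mxE mulrC.
have imL_sub : (L <= kermx m)%MS.
  apply/row_subP => i; rewrite rowE -(fctK (delta_mx 0 i)) LE.
  by apply/sub_kermxP; rewrite mE mu_stat; apply/matrixP => ? ?; rewrite !mxE mul0rn.
have kerL_le1 : (\rank (kermx L) <= 1)%N.
  apply: leq_trans (rank_leq_row (const_mx 1 : 'rV[R]_n)).
  apply: mxrankS; apply/row_subP => i.
  have /sub_kermxP : (row i (kermx L) <= kermx L)%MS by exact: row_sub.
  rewrite -(fctK (row i _)) LE => L0; set f := fct _ in L0 *.
  have f_cst := @generator_kernel_cst f.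
  have {}f_cst : forall x y, f x = f y.
    apply: f_cst => x; move/rowP: L0 => /(_ (enum_rank x)).
    by rewrite !mxE enum_rankK.
  have -> : vec f = f (enum_val i) *: const_mx 1.
    by apply/rowP => j; rewrite !mxE mulr1; exact: f_cst.
  exact: scalemx_sub.
have m_neq0 : m != 0.
  apply/eqP => m0; have := mE (fun=> 1); rewrite m0 mulmx0 (expect_cst mu_prob).
  by move=> /matrixP/(_ 0 0) /eqP; rewrite !mxE eqxx eq_sym oner_eq0.
have rank_m : (0 < \rank m)%N by rewrite lt0n mxrank_eq0.
have kerm_sub : (kermx m <= L)%MS.
  rewrite -(geq_leqif (mxrank_leqif_sup imL_sub)) mxrank_ker.
  by move: kerL_le1 rank_m; rewrite mxrank_ker; lia.
have /submxP[u gE] : (vec g <= L)%MS.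
  apply: submx_trans kerm_sub; apply/sub_kermxP; rewrite mE g0.
  by apply/matrixP => ? ?; rewrite !mxE mul0rn.
exists (fct u) => x; move: gE; rewrite -(fctK u) LE => /rowP/(_ (enum_rank x)).
by rewrite !mxE enum_rankK fctK.
Qed.

End Poisson.

(** * Discrete and continuous harmonic functions *)

(** The triangle is 0 <= j < k <= N.  Next to the diagonal a point has only two
    neighbours, because the other two would cross the diagonal.  In both
    equations the left neighbour [(j, k)] of [(j.+1, k)] occurs, so a maximum
    above the boundary values would propagate to the left side. *)
Lemma triangle_max_principle (R : realType) (N : nat) (e : R)
    (w : nat -> nat -> R) : 0 <= e ->
  (forall k, (0 < k <= N)%N -> w 0 k <= e) ->
  (forall j, (j < N)%N -> w j N <= e) ->
  (forall j k, (j.+2 < k < N)%N ->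
     w j k + w j.+2 k + w j.+1 k.-1 + w j.+1 k.+1 = 4 * w j.+1 k) ->
  (forall j, (j.+2 < N)%N -> w j j.+2 + w j.+1 j.+3 = 2 * w j.+1 j.+2) ->
  forall j k, (j < k <= N)%N -> w j k <= e.
Proof.
move=> e_ge0 w_left w_right w_bulk w_diag j0 k0 jk0.
pose W (x : 'I_N.+1 * 'I_N.+1) := w x.1 x.2.
pose P (x : 'I_N.+1 * 'I_N.+1) := (x.1 < x.2)%N.
have [lj0 lk0] : (j0 < N.+1)%N /\ (k0 < N.+1)%N by lia.
have P0 : P (Ordinal lj0, Ordinal lk0) by rewrite /P /=; lia.
case: (arg_maxP W P0) => [[a b] Pab Wmax]; rewrite /W /P {W P P0} /= in Pab Wmax.
have {}Wmax j k : (j < k <= N)%N -> w j k <= w a b.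
  move=> jk; have [lj lk] : (j < N.+1)%N /\ (k < N.+1)%N by lia.
  by apply: (Wmax (Ordinal lj, Ordinal lk)) => /=; lia.
apply: le_trans (Wmax _ _ jk0) _; rewrite leNgt; apply/negP => e_lt.
suff not_attained j k : (j < k <= N)%N -> w j k < w a b.
  by have := not_attained a b; rewrite ltxx Pab -ltnS ltn_ord => /(_ isT).
elim: j k => [|j IH] k jk; first by apply: le_lt_trans e_lt; apply: w_left; lia.
have [->|kN] := eqVneq k N; first by apply: le_lt_trans e_lt; apply: w_right; lia.
have [->|kj] := eqVneq k j.+2.
  have := w_diag j; have := IH j.+2; have := Wmax j.+1 j.+3.
  by move=> /(_ ltac:(lia)) ? /(_ ltac:(lia)) ? /(_ ltac:(lia)) ?; lra.
have := w_bulk j k; have := IH k; have := Wmax j.+2 k.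
have := Wmax j.+1 k.-1; have := Wmax j.+1 k.+1.
move=> /(_ ltac:(lia)) ? /(_ ltac:(lia)) ? /(_ ltac:(lia)) ? /(_ ltac:(lia)) ?.
by move=> /(_ ltac:(lia)) ?; lra.
Qed.

Lemma discrete_harmonic_affine (R : realType) (N : nat) (u : nat -> R) :
  (0 < N)%N ->
  (forall k, (k.+1 < N)%N -> u k + u k.+2 - 2 * u k.+1 = 0) ->
  forall k, (k <= N)%N -> u k = u 0%N + k%:R / N%:R * (u N - u 0%N).
Proof.
move=> N_gt0 harm.
have slope k : (k.+1 <= N)%N -> u k.+1 - u k = u 1%N - u 0%N.
  elim: k => // k IH kN; rewrite -(IH (ltnW kN)).
  by have := harm k kN; lra.
have aff k : (k <= N)%N -> u k = u 0%N + k%:R * (u 1%N - u 0%N).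
  elim: k => [|k IH] kN; first by rewrite mul0r addr0.
  have := slope k kN; rewrite (IH (ltnW kN)) -natr1 mulrDl mul1r; lra.
move=> k kN; rewrite aff // [in u N](aff N) //.
have N_neq0 : N%:R != 0 :> R by rewrite pnatr_eq0 -lt0n.
by field.
Qed.

Section Dirichlet.
Variables (R : realType) (a b : R).

Definition affine_interp (x : R) : R := a + x * (b - a).

Lemma derive1_affine_interp : derive1 affine_interp = cst (b - a).
Proof.
apply/funext => x; rewrite derive1E; apply: derive_val.
by apply: is_derive_eq; rewrite /GRing.scale /=; ring.
Qed.

Lemma dirichlet_affine_interp : dirichlet_solution a b affine_interp.
Proof.
have diff x : derivable affine_interp x 1.
  by apply: derivableD => //; apply: derivableM.
split.
- apply: derivable_within_continuous => x _; exact: diff.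
- move=> x _; split; first exact: diff.
    by rewrite derive1_affine_interp; exact: derivable_cst.
  by rewrite derive1_affine_interp derive1_cst.
- by rewrite /affine_interp mul0r addr0.
- by rewrite /affine_interp mul1r addrC subrK.
Qed.

(** By the mean value theorem on [v], each chord from 0 has slope [v' s] for
    some [s] in (0,1); by the same theorem on [v'], which has zero derivative, all
    these slopes agree, and the chord up to 1 has slope [b - a]. *)
Lemma dirichlet_solution_unique (v : R -> R) : dirichlet_solution a b v ->
  forall x, 0 <= x <= 1 -> v x = affine_interp x.
Proof.
move=> [v_cont v_harm v0 v1].
have mean y : 0 < y <= 1 -> exists2 s, 0 < s < 1 & v y = a + derive1 v s * y.
  move=> /andP[y0 y1].
  have [||s] := @MVT R v (derive1 v) 0 y y0.
  - move=> s; rewrite in_itv /= => /andP[s0 sy].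
    have [|+ _ _] := v_harm s; first by rewrite s0 (lt_le_trans sy).
    by rewrite derive1E => /derivableP.
  - apply: continuous_subspaceW v_cont => z /=; rewrite !in_itv /=.
    by move=> /andP[-> /le_trans]; exact.
  rewrite in_itv /= v0 => /andP[s0 sy] e.
  exists s; first by rewrite s0 (lt_le_trans sy).
  by rewrite subr0 in e; rewrite -e addrC subrK.
have slope_cst s t : 0 < s -> s < t -> t < 1 -> derive1 v s = derive1 v t.
  move=> s0 st t1; have [||c] := @MVT R (derive1 v) (derive1 (derive1 v)) s t st.
  - move=> c; rewrite in_itv /= => /andP[sc ct].
    have [|_ + _] := v_harm c; first by rewrite (lt_trans s0) // (lt_trans ct).
    by rewrite [X in is_derive _ _ _ X]derive1E => /derivableP.
  - apply: derivable_within_continuous => z; rewrite in_itv /= => /andP[sz zt].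
    by have [] := v_harm z; rewrite ?(lt_le_trans s0) // (le_lt_trans zt).
  rewrite in_itv /= => /andP[sc ct]; have [|_ _ ->] := v_harm c.
    by rewrite (lt_trans s0) // (lt_trans ct).
  by rewrite mul0r => /eqP; rewrite subr_eq0 => /eqP.
move=> x /andP[x0 x1].
have [->|x_neq0] := eqVneq x 0; first by rewrite v0 /affine_interp mul0r addr0.
have [|s /andP[s0 s1] ->] := mean x; first by rewrite lt_neqAle eq_sym x_neq0 x0.
have [|t /andP[t0 t1]] := mean 1; first by rewrite ltr01 lexx.
have -> : derive1 v t = derive1 v s.
  by case: (ltgtP s t) => [?|?|->//]; [symmetry|]; exact: slope_cst.
by rewrite v1 mulr1 /affine_interp => ->; ring.
Qed.

End Dirichlet.
Lemma within_continuous_bounded (R : realType) (G : R -> R) :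
  {within `[0, 1], continuous G} ->
  exists2 M, 0 < M & forall x, 0 <= x <= 1 -> `|G x| <= M.
Proof.
move=> G_cont.
have [c _ Gc] := @EVT_max R G 0 1 ler01 G_cont.
have [d _ Gd] := @EVT_min R G 0 1 ler01 G_cont.
exists (`|G c| + `|G d| + 1); first by rewrite ltr_wpDl ?addr_ge0.
move=> x x01; rewrite ler_norml.
have xI : x \in `[0, 1]%R by rewrite in_itv.
have := Gc x xI; have := Gd x xI; have := ler_norm (G c).
have := ler_norm (- G d); rewrite normrN => ? ? ? ?.
by have := normr_ge0 (G c); have := normr_ge0 (G d); lra.
Qed.

(** * The generator on functions of few sites *)

Section Dynamics.
Variables (R : realType) (p N : nat).
Hypothesis N_ge2 : (2 <= N)%N.
Implicit Types (eta : Omega p N) (f g : Omega p N -> R).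

Lemma site_val (k : nat) : (k < N)%N -> site p N k%:Z = (k + p)%N :> nat.
Proof. by move=> kN; rewrite /site -PoszD absz_nat inordK //; lia. Qed.

Lemma site_eq (j k : nat) : (j < N)%N -> (k < N)%N ->
  (site p N j%:Z == site p N k%:Z) = (j == k).
Proof. by move=> jN kN; rewrite -val_eqE /= !site_val // eqn_add2r. Qed.

Lemma occ_exchange (i k : nat) eta : (i.+1 < N)%N -> (k < N)%N ->
  occ R (exchange i%:Z i.+1%:Z eta) k%:Z =
  if k == i then occ R eta i.+1%:Z else
  if k == i.+1 then occ R eta i%:Z else occ R eta k%:Z.
Proof.
move=> iN kN; rewrite /occ ffunE.
case: tpermP => [/eqP|/eqP|/eqP + /eqP]; rewrite !site_eq ?(ltnW iN) //.
- by move=> ->.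
- by move=> /eqP ->; rewrite eqxx gtn_eqF.
- by move=> /negbTE -> /negbTE ->.
Qed.

Lemma occ_flip (k : nat) eta : (k < N)%N ->
  occ R (flip N.-1%:Z eta) k%:Z =
  if k == N.-1 then 1 - occ R eta k%:Z else occ R eta k%:Z.
Proof.
move=> kN; rewrite /occ ffunE site_eq //; last by lia.
by case: (k == N.-1) => //; case: (eta _); rewrite ?subrr ?subr0.
Qed.

Lemma occ_set_left (k : nat) xi eta : (0 < k < N)%N ->
  occ R (set_left xi eta) k%:Z = occ R eta k%:Z.
Proof. by move=> kN; rewrite /occ ffunE site_val ?ifF //; lia. Qed.

(** The left block consists of the ordinals [0, ..., p], which stand for the
    sites [-p, ..., 0]. *)
Lemma left_part_ext eta eta' :
  (forall i : Lambda p N, (i <= p)%N -> eta i = eta' i) ->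
  left_part eta = left_part eta'.
Proof.
move=> ee; apply/ffunP => i; rewrite !ffunE; apply: ee.
have ip : (i < p.+1)%N by exact: ltn_ord i.
by rewrite inordK //; lia.
Qed.

Lemma left_part_set_left xi eta : left_part (set_left xi eta) = xi.
Proof.
apply/ffunP => i; rewrite !ffunE.
have ip : (i < p.+1)%N by exact: ltn_ord i.
by rewrite inordK ?ifT ?inord_val //; lia.
Qed.

Lemma set_left_left_part eta : set_left (left_part eta) eta = eta.
Proof.
apply/ffunP => i; rewrite !ffunE; case: ifP => // ip.
by congr (eta _); apply: val_inj; rewrite /= inordK inordK //; lia.
Qed.

Lemma left_part_exchange (i : nat) eta : (0 < i)%N -> (i.+1 < N)%N ->
  left_part (exchange i%:Z i.+1%:Z eta) = left_part eta.
Proof.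
move=> i0 iN; apply: left_part_ext => k kp; rewrite ffunE tpermD //.
  by apply/eqP => /(congr1 val) /=; rewrite site_val; lia.
by apply/eqP => /(congr1 val) /=; rewrite site_val; lia.
Qed.

Lemma left_part_flip eta : left_part (flip N.-1%:Z eta) = left_part eta.
Proof.
apply: left_part_ext => k kp; rewrite ffunE ifF //.
by apply/eqP => /(congr1 val) /=; rewrite site_val; lia.
Qed.

Lemma occ_left_part eta : occ R (left_part eta) 0 = occ R eta 0.
Proof.
have site0 : inord (site p 1 0) = site p N 0.
  by apply: val_inj; rewrite /= -[0]/(0%:Z) /site -PoszD absz_nat !inordK //; lia.
by rewrite /occ ffunE site0.
Qed.

Definition bond_diff (i : nat) f eta : R :=
  f (exchange i%:Z i.+1%:Z eta) - f eta.

Definition flip_diff f eta : R := f (flip N.-1%:Z eta) - f eta.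

Definition flip_rate (beta : R) eta : R :=
  beta * (1 - occ R eta N.-1%:Z) + (1 - beta) * occ R eta N.-1%:Z.

(** The contributions to [L (f g) - f L g - g L f] of the three kinds of jumps:
    resampling of the left block, exchanges and the right flip. *)
Definition left_carre (r : Omega p 1 -> Omega p 1 -> R) f g eta : R :=
  \sum_xi r (left_part eta) xi *
     ((f (set_left xi eta) - f eta) * (g (set_left xi eta) - g eta)).

Definition carre_du_champ (beta l : R) r f g eta : R :=
  l * left_carre r f g eta
  + \sum_(0 <= i < N.-1) bond_diff i f eta * bond_diff i g eta
  + flip_rate beta eta * (flip_diff f eta * flip_diff g eta).

(** The bond (0,1) joins the bulk bonds: away from the fast part, sites 0 and 1
    are exchanged as any other pair. *)
Lemma L_fullE (beta l : R) r f eta :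
  L_full beta l r f eta =
  l * L_left r f eta + \sum_(0 <= i < N.-1) bond_diff i f eta
  + flip_rate beta eta * flip_diff f eta.
Proof.
rewrite [in RHS]big_ltn; last by lia.
by rewrite /L_full !addrA.
Qed.

Lemma L_leftE r f eta : L_left r f eta =
  \sum_xi r (left_part eta) xi * (f (set_left xi eta) - f eta).
Proof. by rewrite /L_left /generator set_left_left_part. Qed.

Lemma L_full_mul (beta l : R) r f g eta :
  L_full beta l r (fun x => f x * g x) eta =
  f eta * L_full beta l r g eta + g eta * L_full beta l r f eta
  + carre_du_champ beta l r f g eta.
Proof.
have leibniz a b a' b' : a' * b' - a * b =
    a * (b' - b) + b * (a' - a) + (a' - a) * (b' - b) :> R by ring.
rewrite !L_fullE /carre_du_champ.
have -> : L_left r (fun x => f x * g x) eta =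
    f eta * L_left r g eta + g eta * L_left r f eta + left_carre r f g eta.
  rewrite !L_leftE !mulr_sumr -!big_split; apply: eq_bigr => xi _ /=.
  by rewrite leibniz; ring.
have -> : \sum_(0 <= i < N.-1) bond_diff i (fun x => f x * g x) eta =
    f eta * (\sum_(0 <= i < N.-1) bond_diff i g eta)
    + g eta * (\sum_(0 <= i < N.-1) bond_diff i f eta)
    + \sum_(0 <= i < N.-1) bond_diff i f eta * bond_diff i g eta.
  rewrite !mulr_sumr -!big_split; apply: eq_bigr => i _ /=.
  exact: leibniz.
have -> : flip_diff (fun x => f x * g x) eta =
    f eta * flip_diff g eta + g eta * flip_diff f eta
    + flip_diff f eta * flip_diff g eta by exact: leibniz.
by ring.
Qed.

Lemma L_full_cst (beta l : R) r c eta : L_full beta l r (fun=> c) eta = 0.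
Proof.
rewrite L_fullE L_leftE !big1 => [|i _|xi _];
  rewrite /flip_diff /bond_diff ?subrr ?mulr0 //.
by rewrite !addr0.
Qed.

Lemma L_full_shift (beta l : R) r f c eta :
  L_full beta l r (fun x => f x - c) eta = L_full beta l r f eta.
Proof.
have sh a b : a - c - (b - c) = a - b :> R by ring.
rewrite !L_fullE // !L_leftE /flip_diff sh; congr (_ * _ + _ + _).
  by apply: eq_bigr => xi _; rewrite sh.
by apply: eq_bigr => i _; rewrite /bond_diff sh.
Qed.

Lemma carre_shift (beta l : R) r f g c d eta :
  carre_du_champ beta l r (fun x => f x - c) (fun x => g x - d) eta =
  carre_du_champ beta l r f g eta.
Proof.
have sh e a b : a - e - (b - e) = a - b :> R by ring.
rewrite /carre_du_champ /flip_diff !sh; congr (_ * _ + _ + _).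
  by apply: eq_bigr => xi _; rewrite !sh.
by apply: eq_bigr => i _; rewrite /bond_diff !sh.
Qed.

(** Among the slow jumps, only the exchange of sites 0 and 1 changes the left
    block. *)
Lemma L_full_left (beta l : R) r (F : Omega p 1 -> R) eta :
  L_full beta l r (fun x => F (left_part x)) eta =
  l * generator r F (left_part eta)
  + bond_diff 0 (fun x => F (left_part x)) eta.
Proof.
rewrite L_fullE /L_left /flip_diff left_part_flip subrr mulr0 addr0.
rewrite big_ltn; last by lia.
rewrite big_nat_cond big1 ?addr0 => [|i]; last first.
  by rewrite andbT => iN; rewrite /bond_diff left_part_exchange ?subrr //; lia.
by congr (_ * _ + _); apply: eq_bigr => xi _; rewrite !left_part_set_left.
Qed.

(** The fast part drops out because [g] ignores the left block; this removes the
    factor [l] from the cross term. *)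
Lemma carre_left (beta l : R) r (F : Omega p 1 -> R) g eta :
  (forall xi, g (set_left xi eta) = g eta) ->
  carre_du_champ beta l r (fun x => F (left_part x)) g eta =
  bond_diff 0 (fun x => F (left_part x)) eta * bond_diff 0 g eta.
Proof.
move=> gl; rewrite /carre_du_champ /left_carre big1 => [|xi _]; last first.
  by rewrite gl subrr !mulr0.
have -> : flip_diff (fun x => F (left_part x)) eta = 0.
  by rewrite /flip_diff left_part_flip subrr.
rewrite mul0r !mulr0 addr0 add0r.
rewrite big_ltn; last by lia.
rewrite big_nat_cond big1 ?addr0 // => i.
by rewrite andbT => iN; rewrite /bond_diff left_part_exchange ?subrr
  ?mul0r //; lia.
Qed.

Variable beta : R.

(** The right reservoir as a frozen site N of value [beta]: with this convention
    the boundary equation at N-1 has the same form as those in the bulk. *)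
Definition occ_res (k : nat) eta : R :=
  if (k < N)%N then occ R eta k%:Z else beta.

Lemma occ_res_set_left (k : nat) xi eta : (0 < k)%N ->
  occ_res k (set_left xi eta) = occ_res k eta.
Proof.
by move=> k0; rewrite /occ_res; case: ifP => // kN; rewrite occ_set_left ?k0.
Qed.

Lemma occ_bounds (k : int) eta : 0 <= occ R eta k <= 1.
Proof. by rewrite /occ; case: (eta _); rewrite ?lexx ler01. Qed.

Lemma bond_diff_occ (i k : nat) eta : (i.+1 < N)%N -> (k < N)%N ->
  bond_diff i (occ_res k) eta =
  (if i == k then occ_res k.+1 eta - occ_res k eta else 0)
  + (if i.+1 == k then occ_res k.-1 eta - occ_res k eta else 0).
Proof.
move=> iN kN; rewrite /bond_diff /occ_res kN occ_exchange //.
rewrite [k == i]eq_sym [k == i.+1]eq_sym.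
have [<-|ik] := eqVneq i k; first by rewrite iN gtn_eqF // addr0.
have [<-|ik'] := eqVneq i.+1 k; first by rewrite /= (ltnW iN) add0r.
by rewrite subrr addr0.
Qed.

(** Both flip rates give a drift [beta - eta_{N-1}], as an exchange with a site
    of value [beta] would. *)
Lemma flip_diff_occ (k : nat) eta : (k < N)%N ->
  flip_rate beta eta * flip_diff (occ_res k) eta =
  if k == N.-1 then beta - occ_res k eta else 0.
Proof.
move=> kN; rewrite /flip_diff /occ_res kN occ_flip //.
case: eqP => [->|_]; last by rewrite subrr mulr0.
by rewrite /flip_rate /occ; case: (eta _) => /=; ring.
Qed.

Lemma L_full_occ l r (k : nat) eta : (k.+1 < N)%N ->
  L_full beta l r (occ_res k.+1) eta =
  occ_res k eta + occ_res k.+2 eta - 2 * occ_res k.+1 eta.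
Proof.
move=> kN; rewrite L_fullE L_leftE big1 => [|xi _]; last first.
  by rewrite occ_res_set_left // subrr mulr0.
rewrite mulr0 add0r flip_diff_occ //.
rewrite (eq_big_nat _ _ (F2 := fun i =>
  (if i == k.+1 then occ_res k.+2 eta - occ_res k.+1 eta else 0) +
  (if i == k then occ_res k eta - occ_res k.+1 eta else 0))); last first.
  by move=> i iN; rewrite bond_diff_occ ?eqSS //; lia.
rewrite big_split /= -!big_mkcond !big_nat1_eq /=.
have -> : (k < N.-1)%N by lia.
have [kN1|kN1] := eqVneq k.+1 N.-1.
  rewrite ifF; last by lia.
  rewrite [occ_res k.+2]/occ_res ifF; last by lia.
  by ring.
rewrite ifT; last by lia.
by ring.
Qed.

(** A single jump changes both variables only if it exchanges two neighbouring
    sites [j] and [k], and their increments are then opposite. *)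
Lemma carre_occ l r (j k : nat) eta : (0 < j)%N -> (j < k)%N -> (k < N)%N ->
  carre_du_champ beta l r (occ_res j) (occ_res k) eta =
  - (if k == j.+1 then (occ_res j eta - occ_res k eta) ^+ 2 else 0).
Proof.
move=> j0 jk kN; rewrite /carre_du_champ /left_carre big1 => [|xi _]; last first.
  by rewrite occ_res_set_left // subrr mul0r mulr0.
rewrite mulr0 add0r mulrA flip_diff_occ; last by lia.
rewrite ifF ?mul0r ?addr0; last by lia.
rewrite (eq_big_nat _ _ (F2 := fun i => if i == j then
   - (if k == j.+1 then (occ_res j eta - occ_res k eta) ^+ 2 else 0) else 0)).
  by rewrite -big_mkcond big_nat1_eq ifT //; lia.
move=> i iN; rewrite !bond_diff_occ; [|lia..].
have [->|ij] := eqVneq i j.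
  rewrite ifF; last by lia.
  rewrite ifF; last by lia.
  rewrite (eq_sym k); case: eqP => [<-|_] /=; last by rewrite !addr0 mulr0 oppr0.
  by ring.
have [e|_] := eqVneq i.+1 j; last by rewrite addr0 mul0r.
rewrite ifF; last by lia.
rewrite ifF; last by lia.
by rewrite !addr0 mulr0.
Qed.

End Dynamics.

(** * Stationary means and correlations *)

Section StationaryState.
Variables (R : realType) (p N : nat).
Hypothesis N_ge2 : (2 <= N)%N.
Variables (beta l : R) (r : Omega p 1 -> Omega p 1 -> R) (nu : Omega p N -> R).
Hypotheses (beta_bounds : 0 < beta < 1) (l_gt0 : 0 < l).
Hypothesis nu_stat : stationary (L_full beta l r) nu.

Let nu_prob : prob_mass nu := nu_stat.1.
Let N_neq0 : N%:R != 0 :> R. Proof. by rewrite pnatr_eq0; lia. Qed.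

Definition mean_occ (k : nat) : R := expect nu (occ_res beta k).
Definition dev (k : nat) (eta : Omega p N) : R :=
  occ_res beta k eta - mean_occ k.
Definition corr (j k : nat) : R := expect nu (fun eta => dev j eta * dev k eta).

Lemma mean_occ_right : mean_occ N = beta.
Proof.
rewrite -[RHS](expect_cst nu_prob); apply: expect_ext => eta.
by rewrite /occ_res ltnn.
Qed.

Lemma mean_occ_harmonic k : (k.+1 < N)%N ->
  mean_occ k + mean_occ k.+2 - 2 * mean_occ k.+1 = 0.
Proof.
move=> kN; rewrite -[RHS](nu_stat.2 (occ_res beta k.+1)).
rewrite -expectZ -expectD -expectB.
by apply: expect_ext => eta; rewrite L_full_occ.
Qed.

Lemma mean_occ_affine k : (k <= N)%N ->
  mean_occ k = mean_occ 0%N + k%:R / N%:R * (beta - mean_occ 0%N).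
Proof.
rewrite -mean_occ_right; apply: discrete_harmonic_affine; first by lia.
exact: mean_occ_harmonic.
Qed.

Lemma occ_res_bounds k (eta : Omega p N) : 0 <= occ_res beta k eta <= 1.
Proof.
rewrite /occ_res; case: ifP => _; first exact: occ_bounds.
by case/andP: beta_bounds => /ltW -> /ltW ->.
Qed.

Lemma mean_occ_bounds k : 0 <= mean_occ k <= 1.
Proof.
rewrite -(expect_cst nu_prob 0) -(expect_cst nu_prob 1).
by apply/andP; split; apply: expect_le => // eta;
  case/andP: (occ_res_bounds k eta).
Qed.

Lemma dev_norm_le1 k eta : `|dev k eta| <= 1.
Proof.
rewrite ler_norml /dev; have := occ_res_bounds k eta; have := mean_occ_bounds k.
by move=> /andP[? ?] /andP[? ?]; lra.
Qed.

Lemma expect_dev k : expect nu (dev k) = 0.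
Proof. by rewrite /dev expectB expect_cst // subrr. Qed.

Lemma L_full_dev k eta : (k.+1 < N)%N ->
  L_full beta l r (dev k.+1) eta = dev k eta + dev k.+2 eta - 2 * dev k.+1 eta.
Proof.
move=> kN; rewrite /dev L_full_shift // L_full_occ //.
by have := mean_occ_harmonic kN; lra.
Qed.

Lemma corr_sym j k : corr j k = corr k j.
Proof. by apply: expect_ext => eta; rewrite mulrC. Qed.

Lemma corr_right j : corr j N = 0.
Proof.
rewrite -[RHS](expect_cst nu_prob); apply: expect_ext => eta.
by rewrite {2}/dev mean_occ_right /occ_res ltnn subrr mulr0.
Qed.

(** Stationarity tested against [dev j.+1 * dev k.+1].  For [k = j.+1] the left
    side contains the diagonal values [corr j.+1 j.+1] and [corr j.+2 j.+2],
    which the square on the right cancels (see [corr_diag]). *)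
Lemma corr_equation j k : (j.+1 < k.+1)%N -> (k.+1 < N)%N ->
  corr j k.+1 + corr j.+2 k.+1 + corr j.+1 k + corr j.+1 k.+2 - 4 * corr j.+1 k.+1
  = if k == j.+1 then
      expect nu (fun eta => (occ_res beta j.+1 eta - occ_res beta k.+1 eta) ^+ 2)
    else 0.
Proof.
move=> jk kN; apply/eqP; rewrite -subr_eq0; apply/eqP.
rewrite -[RHS](nu_stat.2 (fun eta => dev j.+1 eta * dev k.+1 eta)).
have -> : (if k == j.+1 then
    expect nu (fun eta => (occ_res beta j.+1 eta - occ_res beta k.+1 eta) ^+ 2)
    else 0) = expect nu (fun eta => if k == j.+1 then
      (occ_res beta j.+1 eta - occ_res beta k.+1 eta) ^+ 2 else 0).
  by case: ifP => // _; rewrite expect_cst.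
rewrite /corr -expectZ -!expectD -!expectB; apply: expect_ext => eta.
rewrite L_full_mul // L_full_dev // L_full_dev; last by lia.
rewrite carre_shift carre_occ // eqSS.
by case: ifP => _; ring.
Qed.

Let slope : R := (beta - mean_occ 0%N) / N%:R.

(** Centring at the exact stationary means makes the linear part of the square
    vanish, so that only the deterministic source [slope ^+ 2] remains. *)
Lemma corr_diag j : (j.+2 < N)%N ->
  corr j j.+2 + corr j.+1 j.+3 = 2 * corr j.+1 j.+2 + slope ^+ 2.
Proof.
move=> jN; have := @corr_equation j j.+1; rewrite eqxx => /(_ ltac:(lia)).
move=> /(_ ltac:(lia)).
have -> : expect nu (fun eta =>
      (occ_res beta j.+1 eta - occ_res beta j.+2 eta) ^+ 2) =
    corr j.+1 j.+1 + corr j.+2 j.+2 - 2 * corr j.+1 j.+2 + slope ^+ 2.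
  (* The middle term is zero; it is displayed so that the identity holds
     pointwise under the expectation. *)
  transitivity (corr j.+1 j.+1 + corr j.+2 j.+2 - 2 * corr j.+1 j.+2
    - 2 * slope * (expect nu (dev j.+1) - expect nu (dev j.+2)) + slope ^+ 2).
    rewrite -[slope ^+ 2](expect_cst nu_prob) /corr -!expectB -!expectZ.
    rewrite -!expectD -!expectB -!expectD; apply: expect_ext => eta.
    rewrite /dev (mean_occ_affine (k := j.+1)); last by lia.
    rewrite (mean_occ_affine (k := j.+2)); last by lia.
    rewrite /slope -[in j.+2%:R]natr1; move: (mean_occ 0) => m0; field.
    exact: N_neq0.
  by rewrite !expect_dev; ring.
by lra.
Qed.

Section LeftBoundary.
Variables (alpha K : R) (F : Omega p 1 -> R).
Hypothesis F_poisson : forall xi, generator r F xi = occ R xi 0 - alpha.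
Hypothesis F_bound : forall xi, `|F xi| <= K.

(** Stationarity of [F(left block) * g]: the fast part produces
    [l * (eta_0 - alpha) * g], and every other term is bounded by a multiple of
    [K] independent of [l].  The constants 1 and 4 are those satisfied by
    centred occupation variables, and 10 = 4 + 2 + 4 collects the three
    remaining terms. *)
Lemma left_decoupling (g : Omega p N -> R) :
  (forall xi eta, g (set_left xi eta) = g eta) ->
  (forall eta, `|g eta| <= 1) -> (forall eta, `|L_full beta l r g eta| <= 4) ->
  `|expect nu (fun eta => (occ_res beta 0 eta - alpha) * g eta)| <= 10 * K / l.
Proof.
move=> g_left g_le1 Lg_le4; pose Fl (eta : Omega p N) := F (left_part eta).
pose rest eta := Fl eta * L_full beta l r g eta + g eta * bond_diff 0 Fl eta
  + bond_diff 0 Fl eta * bond_diff 0 g eta.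
have occ0 (eta : Omega p N) : occ_res beta 0 eta = occ R (left_part eta) 0.
  by rewrite occ_left_part // /occ_res ifT //; lia.
have balance : l * expect nu (fun eta => (occ_res beta 0 eta - alpha) * g eta) =
    - expect nu rest.
  apply/eqP; rewrite -subr_eq0 opprK -expectZ -expectD; apply/eqP.
  rewrite -[RHS](nu_stat.2 (fun eta => Fl eta * g eta)); apply: expect_ext => eta.
  rewrite L_full_mul // L_full_left // carre_left // F_poisson -occ0 /rest.
  by rewrite -/(Fl); ring.
have bond_le (f : Omega p N -> R) c eta : (forall x, `|f x| <= c) ->
    `|bond_diff 0 f eta| <= 2 * c.
  move=> fc; rewrite /bond_diff; apply: le_trans (ler_normB _ _) _.
  rewrite mulr2n mulrDl !mul1r.
  exact: lerD.
rewrite ler_pdivlMr // -[l in X in X <= _](gtr0_norm l_gt0) -normrM mulrC balance.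
rewrite normrN; apply: expect_norm_le => // eta; rewrite /rest.
have Fb := @bond_le Fl K eta (fun x => F_bound (left_part x)).
have Flb : `|Fl eta| <= K := F_bound (left_part eta).
have gb := @bond_le g 1 eta g_le1.
have -> : 10 * K = K * 4 + 1 * (2 * K) + (2 * K) * (2 * 1) by ring.
apply: le_trans (ler_normD _ _) _; apply: lerD; last by rewrite normrM ler_pM.
by apply: le_trans (ler_normD _ _) _; rewrite !normrM lerD // ler_pM.
Qed.

Lemma left_density_close : `|mean_occ 0 - alpha| <= 10 * K / l.
Proof.
have := @left_decoupling (fun=> 1); rewrite normr1.
have -> : expect nu (fun eta => (occ_res beta 0 eta - alpha) * 1) =
    mean_occ 0 - alpha.
  by rewrite -[in RHS](expect_cst nu_prob alpha) -expectB;
     apply: expect_ext => eta; rewrite mulr1.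
by apply => // eta; rewrite L_full_cst // normr0.
Qed.

Lemma corr_left k : (0 < k <= N)%N -> `|corr 0 k| <= 10 * K / l.
Proof.
have K_ge0 : 0 <= K by apply: le_trans (F_bound (finfun (fun=> true))).
have [->|kN] := eqVneq k N.
  by rewrite corr_right normr0 divr_ge0 ?mulr_ge0 // ltW.
case: k kN => // k kN kN'.
have -> : corr 0 k.+1 =
    expect nu (fun eta => (occ_res beta 0 eta - alpha) * dev k.+1 eta).
  transitivity (corr 0 k.+1 + (mean_occ 0 - alpha) * expect nu (dev k.+1)).
    by rewrite expect_dev mulr0 addr0.
  rewrite -expectZ -expectD; apply: expect_ext => eta.
  by rewrite {1}/dev; ring.
apply: left_decoupling.
- by move=> xi eta; rewrite /dev occ_res_set_left.
- exact: dev_norm_le1.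
- move=> eta; rewrite L_full_dev; last by lia.
  have := dev_norm_le1 k eta; have := dev_norm_le1 k.+1 eta.
  have := dev_norm_le1 k.+2 eta; rewrite !ler_norml.
  by move=> /andP[? ?] /andP[? ?] /andP[? ?]; lra.
Qed.

(** The function [h j k = c * j (N - k)] vanishes on the sides [j = 0] and
    [k = N], is discrete harmonic off the diagonal, and its equation next to the
    diagonal has the defect [- c (N - 1)].  With [c = slope^2 / (N - 1)], the
    sum [corr + h] is harmonic and the maximum principle bounds it by its values on
    the left side. *)
Lemma corr_le j k : (j < k <= N)%N -> `|corr j k| <= 10 * K / l + N%:R^-1.
Proof.
have K_ge0 : 0 <= K by apply: le_trans (F_bound (finfun (fun=> true))).
have b_ge0 : 0 <= 10 * K / l by rewrite divr_ge0 ?mulr_ge0 // ltW.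
have N2 : 2 <= N%:R :> R by rewrite ler_nat.
have N1_neq0 : N%:R - 1 != 0 :> R by rewrite gt_eqF //; lra.
pose h (j k : nat) : R := slope ^+ 2 / (N%:R - 1) * (j%:R * (N%:R - k%:R)).
pose w j k := corr j k + h j k.
have w0 k' : w 0%N k' = corr 0 k' by rewrite /w /h mul0r mulr0 addr0.
have wN j' : w j' N = 0 by rewrite /w /h subrr !mulr0 addr0 corr_right.
have w_bulk j' k' : (j'.+2 < k' < N)%N ->
    w j' k' + w j'.+2 k' + w j'.+1 k'.-1 + w j'.+1 k'.+1 = 4 * w j'.+1 k'.
  case: k' => // k' jk; have := @corr_equation j' k'; rewrite ifF; last by lia.
  move=> /(_ ltac:(lia) ltac:(lia)); rewrite /w /h -!natr1 /=.
  move: (slope ^+ 2 / _) => c e.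
  by rewrite -[LHS]subr0 -[X in _ - X]e; ring.
have w_diag j' : (j'.+2 < N)%N -> w j' j'.+2 + w j'.+1 j'.+3 = 2 * w j'.+1 j'.+2.
  move=> jN; rewrite /w addrACA corr_diag // /h -!natr1.
  by field.
move=> jk; have w_le : w j k <= 10 * K / l.
  apply: triangle_max_principle w_bulk w_diag _ _ jk => //.
    by move=> k' /corr_left; rewrite w0; apply: le_trans; exact: ler_norm.
  by move=> j' _; rewrite wN.
have w_ge : - w j k <= 10 * K / l.
  apply: (triangle_max_principle (N := N) (w := fun j k => - w j k)) jk => //.
  - by move=> k' /corr_left; rewrite w0 -normrN; apply: le_trans; exact: ler_norm.
  - by move=> j' _; rewrite wN oppr0.
  - by move=> j' k' /w_bulk; lra.
  - by move=> j' /w_diag; lra.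
have slope_le : slope ^+ 2 <= N%:R^-1 ^+ 2.
  rewrite /slope exprMn -[leRHS]mul1r ler_wpM2r ?sqr_ge0 //.
  by have := mean_occ_bounds 0; move: beta_bounds => /andP[? ?] /andP[? ?]; nra.
have h_ge0 : 0 <= h j k.
  rewrite /h; apply: mulr_ge0; first by apply: divr_ge0; [exact: sqr_ge0|lra].
  by rewrite mulr_ge0 // subr_ge0 ler_nat; lia.
have h_le : h j k <= N%:R^-1.
  have -> : N%:R^-1 = N%:R^-1 ^+ 2 / (N%:R - 1) * ((N%:R - 1) * N%:R) :> R.
    by field; rewrite N_neq0 N1_neq0.
  have N1 : 0 <= (N%:R - 1)^-1 :> R by rewrite invr_ge0; lra.
  have jN : j%:R + 1 <= N%:R :> R.
    by rewrite natr1 ler_nat; case/andP: jk; exact: leq_trans.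
  have kN : k%:R <= N%:R :> R.
    by rewrite ler_nat; case/andP: jk.
  rewrite /h; apply: ler_pM.
  - by rewrite mulr_ge0 ?sqr_ge0.
  - by rewrite mulr_ge0 ?subr_ge0.
  - exact: ler_wpM2r.
  - by apply: ler_pM; rewrite ?subr_ge0 // ?lerBrDr // lerBlDr lerDl.
by rewrite ler_norml; rewrite /w in w_le w_ge; lra.
Qed.

(** The deviation splits into the fluctuation around the stationary mean,
    controlled by its second moment, and the deterministic difference between
    the mean profile and the affine limit, which is
    [(mean_occ 0 - alpha) * (1 - k / N)].  The parameter [e] is free, to be
    chosen as the target precision. *)
Lemma empirical_average_le (G : R -> R) (M e : R) : 0 <= M -> 0 < e ->
  (forall x, 0 <= x <= 1 -> `|G x| <= M) ->
  expect nu (fun eta => `| N%:R^-1 * \sum_(1 <= k < N) G (k%:R / N%:R) *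
      (occ R eta k%:Z - affine_interp alpha beta (k%:R / N%:R)) |)
  <= (e + M ^+ 2 * (N%:R^-1 + (10 * K / l + N%:R^-1)) / e) / 2
     + M * (10 * K / l).
Proof.
move=> M0 e0 GM; have NR : 0 < N%:R :> R by rewrite ltr0n; lia.
have K_ge0 : 0 <= K by apply: le_trans (F_bound (finfun (fun=> true))).
have b_ge0 : 0 <= 10 * K / l by rewrite divr_ge0 ?mulr_ge0 // ltW.
have macro k : (1 <= k < N)%N -> 0 <= (k%:R / N%:R : R) <= 1.
  by move=> kN; rewrite divr_ge0 //= ler_pdivrMr // mul1r ler_nat; lia.
have corr_bound j k : (1 <= j < N)%N -> (1 <= k < N)%N ->
    `|expect nu (fun eta => dev j eta * dev k eta)|
    <= (j == k)%:R + (10 * K / l + N%:R^-1).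
  move=> jN kN; rewrite -/(corr j k); case: (ltngtP j k) => [jk|kj|<-] /=.
  - by rewrite add0r; apply: corr_le; lia.
  - by rewrite add0r corr_sym; apply: corr_le; lia.
  - apply: (@le_trans _ _ 1); last by rewrite lerDl addr_ge0 // invr_ge0 ltW.
    by apply: expect_norm_le => // eta; rewrite normrM mulr_ile1 ?dev_norm_le1.
pose fluct eta := N%:R^-1 * \sum_(1 <= k < N) G (k%:R / N%:R) * dev k eta.
apply: (@le_trans _ _ (expect nu (fun eta => `|fluct eta| + M * (10 * K / l)))).
  apply: expect_le => // eta.
  have -> : N%:R^-1 * \sum_(1 <= k < N) G (k%:R / N%:R) *
        (occ R eta k%:Z - affine_interp alpha beta (k%:R / N%:R)) =
      fluct eta + N%:R^-1 * \sum_(1 <= k < N) G (k%:R / N%:R) *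
        ((mean_occ 0 - alpha) * (1 - k%:R / N%:R)).
    rewrite -mulrDr -big_split /=; congr (_ * _); apply: eq_big_nat => k kN.
    rewrite -mulrDr; congr (_ * _); rewrite /dev mean_occ_affine; last by lia.
    by rewrite /occ_res ifT /affine_interp; [ring|lia].
  apply: le_trans (ler_normD _ _) _; rewrite lerD2l normrM gtr0_norm ?invr_gt0 //.
  rewrite mulrC ler_pdivrMr //; apply: le_trans (ler_norm_sum _ _ _) _.
  apply: (@le_trans _ _ (\sum_(1 <= k < N) M * (10 * K / l))); last first.
    rewrite sumr_const_nat -[leLHS]mulr_natr ler_wpM2l //.
      exact: mulr_ge0.
    by rewrite ler_nat; lia.
  apply: ler_sum_nat => k kN; rewrite normrM ler_pM ?GM ?macro //.
  rewrite normrM -[leRHS]mulr1 ler_pM ?left_density_close //.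
  by have := macro k kN; rewrite ler_norml => /andP[? ?]; lra.
rewrite expectD expect_cst // lerD2r.
apply: le_trans (expect_norm_le_sqr fluct nu_prob e0) _.
rewrite ler_wpM2r ?invr_ge0 // lerD2l ler_wpM2r ?invr_ge0 ?(ltW e0) //.
apply: second_moment_average => //; first by lia.
  by rewrite addr_ge0 // invr_ge0 ltW.
by move=> k kN; rewrite GM ?macro.
Qed.

End LeftBoundary.
End StationaryState.

(** * The hydrostatic limit *)

Theorem theorem2p9 (R : realType) (p : nat) (beta : R)
    (r : Omega p 1 -> Omega p 1 -> R) (mu : Omega p 1 -> R)
    (ell : nat -> R) (muN : forall N : nat, Omega p N -> R)
    (hp : (1 < p)%N) (hbeta : 0 < beta < 1)
    (hr : jump_rates r) (hirr : irreducible_rates r)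
    (hmu : stationary (generator r) mu)
    (hell_gt0 : forall N : nat, (2 <= N)%N -> 0 < ell N)
    (hell_oo : ell N @[N --> \oo] --> +oo)
    (hmuN : forall N : nat, (2 <= N)%N ->
      stationary (L_full beta (ell N) r) (muN N)) :
  (exists C0 : R, forall N : nat, (2 <= N)%N ->
     `|density (muN N) 0 - density mu 0| <= C0 / Num.sqrt (ell N)) /\
  (exists ubar : R -> R,
     [/\ dirichlet_solution (density mu 0) beta ubar,
         (forall v : R -> R, dirichlet_solution (density mu 0) beta v ->
            forall x : R, 0 <= x <= 1 -> v x = ubar x)
       & forall G : R -> R, {within `[0, 1], continuous G} ->
           expect (muN N) (fun eta =>
             `| N%:R^-1 * \sum_(1 <= k < N)
                  G (k%:R / N%:R) * (occ R eta k%:Z - ubar (k%:R / N%:R)) |)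
           @[N --> \oo] --> (0 : R)]).
Proof.
have alphaE : expect mu (fun xi => occ R xi 0 - density mu 0) = 0.
  by rewrite expectB expect_cst ?subrr //; exact: hmu.1.
have [F F_poisson] := poisson_equation hr hirr hmu alphaE.
pose K := \sum_xi `|F xi|.
have F_bound xi : `|F xi| <= K by rewrite /K (bigD1 xi) //= lerDl sumr_ge0.
have K_ge0 : 0 <= K by rewrite sumr_ge0.
have density_close N : (2 <= N)%N ->
    `|density (muN N) 0 - density mu 0| <= 10 * K / ell N.
  move=> N2.
  have := left_density_close N2 hbeta (hell_gt0 N N2) (hmuN N N2)
    F_poisson F_bound.
  suff -> : mean_occ beta (muN N) 0 = density (muN N) 0 by [].
  by apply: expect_ext => eta; rewrite /occ_res ifT //; lia.
split.
  (* [10 K] serves when [ell N >= 1], and the additional 1 when [ell N < 1]. *)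
  exists (10 * K + 1) => N N2; have l0 := hell_gt0 N N2.
  have s0 : 0 < Num.sqrt (ell N) by rewrite sqrtr_gt0.
  rewrite ler_pdivlMr //; have [l1|l1] := leP 1 (ell N).
    apply: (@le_trans _ _ (10 * K)); last by rewrite lerDl.
    apply: le_trans (_ : 10 * K / ell N * ell N <= _);
      last by rewrite divfK ?gt_eqF.
    have s_ge1 : 1 <= Num.sqrt (ell N) by rewrite -sqrtr1 ler_sqrt // ltW.
    apply: ler_pM (normr_ge0 _) (ltW s0) (density_close N N2) _.
    by rewrite -[leRHS](sqr_sqrtr (ltW l0)) expr2 ler_peMr // ltW.
  apply: (@le_trans _ _ (1 * 1)); last by rewrite mulr1 lerDr mulr_ge0.
  apply: ler_pM; rewrite ?(ltW s0) //; last first.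
    by rewrite -sqrtr1 ler_sqrt // ltW.
  have density01 q (nu : Omega p q -> R) : prob_mass nu ->
      0 <= density nu 0 <= 1.
    move=> nup; rewrite /density -(expect_cst nup 0) -(expect_cst nup 1).
    by apply/andP; split; apply: expect_le => // eta;
      case/andP: (occ_bounds R 0 eta).
  have := density01 _ _ hmu.1; have := density01 _ _ (hmuN N N2).1.
  by rewrite ler_norml => /andP[? ?] /andP[? ?]; lra.
exists (affine_interp (density mu 0) beta); split.
- exact: dirichlet_affine_interp.
- by move=> v /dirichlet_solution_unique.
move=> G /within_continuous_bounded[M M0 GM].
apply/cvgrPdist_le => e e0.
(* With both 1/N and the noise below [small], the two terms of the bound are at
   most [(e + 3 e / 4) / 2] and [e / 8]. *)
pose small := Num.min (e ^+ 2 / (4 * M ^+ 2)) (e / (8 * M)).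
have small0 : 0 < small.
  by rewrite lt_min !divr_gt0 ?exprn_gt0 ?mulr_gt0 ?exprn_gt0.
near=> N.
have N2 : (2 <= N)%N by near: N; exact: nbhs_infty_ge.
have l0 := hell_gt0 N N2.
have NR : 0 < N%:R :> R by rewrite ltr0n; lia.
have noise : 10 * K / ell N <= small.
  rewrite ler_pdivrMr // [small * _]mulrC -ler_pdivrMr // ltW //.
  by near: N; move/cvgryPgt: hell_oo; exact.
have size : N%:R^-1 <= small.
  rewrite invf_ple ?posrE // ltW //; near: N; exact: nbhs_infty_gtr.
rewrite sub0r normrN ger0_norm; last first.
  by apply: sumr_ge0 => eta _; rewrite mulr_ge0 // (hmuN N N2).1.1.
apply: le_trans (empirical_average_le N2 hbeta l0 (hmuN N N2) F_poisson F_bound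
  (ltW M0) e0 GM) _.
have [small1 small2] : M ^+ 2 * small <= e ^+ 2 / 4 /\ M * small <= e / 8.
  split.
    have -> : e ^+ 2 / 4 = M ^+ 2 * (e ^+ 2 / (4 * M ^+ 2)).
      by field; rewrite gt_eqF.
    by rewrite ler_wpM2l ?sqr_ge0 // ge_min lexx.
  have -> : e / 8 = M * (e / (8 * M)) by field; rewrite gt_eqF.
  by rewrite ler_wpM2l ?(ltW M0) // ge_min lexx orbT.
have first_term : M ^+ 2 * (N%:R^-1 + (10 * K / ell N + N%:R^-1)) / e
    <= 3 / 4 * e.
  rewrite ler_pdivrMr //; apply: le_trans (_ : M ^+ 2 * (3 * small) <= _).
    by rewrite ler_wpM2l ?sqr_ge0 //; lra.
  by rewrite mulrCA; lra.
have second_term : M * (10 * K / ell N) <= e / 8.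
  by apply: le_trans small2; rewrite ler_wpM2l // ltW.
by lra.
Unshelve. all: by end_near.
Qed.
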